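(* Let $\Gamma_n$ ($n\in\mathbb N$) be a sequence of nonatomic routing games on a fixed graph with fixed OD pairs $\mathcal I$, path sets $\mathcal P^i$ and edge costs $(c_e)_{e\in\mathcal E}$, where in $\Gamma_n$ OD pair $i$ has demand $m_n^i\ge 0$, with total inflow $M_n=\sum_i m_n^i>0$ and relative inflows $\lambda_n^i=m_n^i/M_n$. Let $c$ be a benchmark for $(c_e)$ at $\omega\in\{0,\infty\}$, and for each $i$ let $\alpha^i=\min_{p\in\mathcal P^i}\max_{e\in p}\alpha_e$ with $\alpha_e=\lim_{x\to\omega}c_e(x)/c(x)$. Suppose that (a) $\lim_{n\to\infty}M_n=\omega$; (b) $\alpha^i<\infty$ for all $i\in\mathcal I$; (c) $\liminf_{n\to\infty}\sum_{i:\alpha^i>0}\lambda_n^i>0$. Then $\mathrm{PoA}(\Gamma_n)\to 1$ as $n\to\infty$.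
   Context: A nonatomic routing game consists of: a finite directed multigraph with edge set $\mathcal E$; a finite set $\mathcal I$ of OD pairs, each $i$ with demand $m^i\ge 0$ and a nonempty finite set $\mathcal P^i$ of paths from its origin to its destination, the $\mathcal P^i$ pairwise disjoint, $\mathcal P=\bigcup_i\mathcal P^i$; and continuous nondecreasing edge costs $c_e:[0,\infty)\to[0,\infty)$. Total inflow $M=\sum_i m^i>0$. Feasible flows: $f\in\mathbb R_+^{\mathcal P}$ with $\sum_{p\in\mathcal P^i}f_p=m^i$; loads $x_e=\sum_{p\ni e}f_p$; path costs $c_p(f)=\sum_{e\in p}c_e(x_e)$. A Wardrop equilibrium is a feasible $f^*$ with $c_p(f^* )\le c_{p'}(f^* )$ whenever $p,p'\in\mathcal P^i$ and $f^*_p>0$. Social cost $L(x)=\sum_e x_ec_e(x_e)$; $\mathrm{Opt}$ its minimum over feasible loads, $\mathrm{Eq}=L(x^* )$ at an equilibrium load (independent of the equilibrium), $\mathrm{PoA}=\mathrm{Eq}/\mathrm{Opt}$ (set to $1$ if $\mathrm{Opt}=0$). A function $g:(0,\infty)\to(0,\infty)$ is regularly varying at $\omega$ if $\lim_{t\to\omega}g(tx)/g(t)$ is finite and nonzero for all $x>0$; a regularly varying (at $\omega$) function $c:(0,\infty)\to(0,\infty)$ is a benchmark for $(c_e)$ at $\omega$ if $\alpha_e=\lim_{x\to\omega}c_e(x)/c(x)\in[0,\infty]$ exists for every edge $e$. An OD pair $i$ is called tight if $0<\alpha^i<\infty$. *)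

(* Defs.v *)
From HB Require Import structures.
From mathcomp Require Import all_boot all_order all_algebra.
From mathcomp Require Import all_classical all_reals all_analysis.
Set Implicit Arguments. Unset Strict Implicit. Unset Printing Implicit Defensive.
Import Order.TTheory GRing.Theory Num.Theory.
Import numFieldNormedType.Exports.
Local Open Scope classical_set_scope.
Local Open Scope ring_scope.

Section Routing.
Variable R : realType.
Variables (V E I P : finType).
Variables (src dst : E -> V).

(* p (a sequence of edges) is a (simple) path from o to d:
   consecutive edges are incident, it starts at o, ends at d,
   and visits no vertex twice. *)
Definition is_path (o d : V) (p : seq E) : Prop :=
  [/\ map src p = belast o (map dst p),
      last o (map dst p) = d &
      uniq (o :: map dst p)].

(* Each path p : P belongs to the OD pair od p and has edge list pe p;
   hence the path sets P^i = [set p | od p = i] are pairwise disjoint. *)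
Variables (od : P -> I) (pe : P -> seq E).
Variable c : E -> R -> R.

Definition flow := {ffun P -> R}.

Definition feasible (m : I -> R) (f : flow) : Prop :=
  (forall p, 0 <= f p) /\ (forall i, \sum_(p | od p == i) f p = m i).

Definition load (f : flow) (e : E) : R := \sum_(p | e \in pe p) f p.

Definition pcost (f : flow) (p : P) : R := \sum_(e <- pe p) c e (load f e).

Definition wardrop_eq (m : I -> R) (f : flow) : Prop :=
  feasible m f /\
  (forall p p', od p = od p' -> 0 < f p -> pcost f p <= pcost f p').

Definition social_cost (f : flow) : R := \sum_(e : E) load f e * c e (load f e).

Definition Opt (m : I -> R) : R := inf [set social_cost g | g in feasible m].

(* Eq: social cost at an equilibrium (independent of the equilibrium chosen) *)
Definition Eq (m : I -> R) : R :=
  social_cost (xget (0 : flow) [set f | wardrop_eq m f]).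

Definition PoA (m : I -> R) : R := if Opt m == 0 then 1 else Eq m / Opt m.

End Routing.

(* the point omega in {0, +oo}: omega_inf = true means omega = +oo,
   omega_inf = false means omega = 0 (approached from the right, i.e.
   within the domain (0, +oo)). *)
Definition omega_nbhs (R : realType) (omega_inf : bool) : set_system R :=
  if omega_inf then pinfty_nbhs R else at_right 0.

Definition regularly_varying (R : realType) (omega_inf : bool) (g : R -> R) : Prop :=
  forall x : R, 0 < x -> exists l : R, l != 0 /\
    (fun t => g (t * x) / g t) @ omega_nbhs omega_inf --> l.

Definition alpha_e (R : realType) (omega_inf : bool) (ce cb : R -> R) : \bar R :=
  lim ((fun x => (ce x / cb x)%:E) @ omega_nbhs omega_inf).

Definition benchmark (R : realType) (E : finType) (omega_inf : bool)
    (c : E -> R -> R) (cb : R -> R) : Prop :=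
  (forall t, 0 < t -> 0 < cb t) /\ regularly_varying omega_inf cb /\
  forall e, exists a : \bar R,
    (fun x => (c e x / cb x)%:E) @ omega_nbhs omega_inf --> a.

Definition alpha_od (R : realType) (E I P : finType) (omega_inf : bool)
    (od : P -> I) (pe : P -> seq E) (c : E -> R -> R) (cb : R -> R) (i : I) : \bar R :=
  \big[Order.min/+oo%E]_(p | od p == i)
     \big[Order.max/0%E]_(e <- pe p) alpha_e omega_inf (c e) cb.

(* Main.v *)
Require Import Defs.
From HB Require Import structures.
From mathcomp Require Import all_boot all_order all_algebra.
From mathcomp Require Import all_classical all_reals all_analysis.
From mathcomp Require Import ring lra.

(** Equilibria exist because a minimiser of Beckmann's potential (the sum over
    edges of the antiderivatives of the costs at the loads) is one, and an
    equilibrium load x satisfies sum_e x_e c_e(x_e) <= sum_e z_e c_e(x_e) for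
    every feasible load z.

    By (b) and (c) some edge has 0 < alpha_e < oo. Its cost is monotone and
    equivalent to alpha_e c, which forces lim c(tx)/c(t) to be a power x^rho
    with rho >= 0. Hence on every edge with alpha_e finite the rescaled cost
    y c_e(My)/c(M) converges to alpha_e y^(1+rho), uniformly on [0,1] by
    monotonicity. By (c), Opt is at least of order M c(M).

    Edges with alpha_e = oo carry a vanishing share of any near-optimal flow, so
    by (b) that flow can be rerouted to a flow z avoiding them, at a negligible
    change of loads. On the remaining edges Young's inequality
    (1+rho) z y^rho <= rho y^(1+rho) + z^(1+rho) turns the variational
    inequality into (1+rho) Eq <= rho Eq + Opt + o(M c(M)), so that
    Eq <= Opt + o(Opt). *)

Set Implicit Arguments. Unset Strict Implicit. Unset Printing Implicit Defensive.
Import Order.TTheory GRing.Theory Num.Theory.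
Import numFieldNormedType.Exports.
Local Open Scope classical_set_scope.
Local Open Scope ring_scope.

(** * Existence of Wardrop equilibria *)

(** Costs are continuous on the half line only; freezing them at their value at 0 extends them
    continuously to all of R, so that calculus applies at load 0 too. *)
Lemma continuous_max0 (R : realType) (g : R -> R) :
  {within `[0, +oo[, continuous g} -> continuous (fun x : R => g (Num.max x 0)).
Proof.
move=> cg x.
have [cg0 cg1] := (continuous_within_itvcyP _ _).1 cg.
have cmax : (fun y : R => Num.max y 0) @ x --> Num.max x 0.
  by apply: continuous_max; [exact: cvg_id | exact: cvg_cst].
have [x0|x0] := ltP 0 x.
  have e : Num.max x 0 = x by rewrite max_l// ltW.
  apply: (cvg_comp _ _ cmax).
  by rewrite e; apply: cg0; rewrite in_itv/= x0.
have e : Num.max x 0 = 0 by rewrite max_r.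
apply/cvgrPdist_le => eps eps0.
move/cvgrPdist_le : cg1 => /(_ eps eps0) [d /= d0 dP].
move/cvgrPdist_lt : cmax => /(_ d d0).
apply: filterS => y; rewrite !e => yd.
have [y0|y0] := ltP 0 (Num.max y 0).
  by apply: dP.
have -> : Num.max y 0 = 0 by apply/eqP; rewrite eq_le y0 le_max lexx orbT.
by rewrite subrr normr0 ltW.
Qed.

(** The inequality is the supporting line of the convex function [G] at [b]; it follows from the
    mean value theorem and monotonicity of [g]. *)
Lemma convex_antiderivative (R : realType) (g : R -> R) :
  {within `[0, +oo[, continuous g} ->
  (forall x y : R, 0 <= x -> x <= y -> g x <= g y) ->
  exists G : R -> R, (forall x : R, 0 <= x -> {for x, continuous G}) /\
    forall a b : R, 0 <= a -> 0 <= b -> G b - G a <= g b * (b - a).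
Proof.
move=> cg ndg; pose h (x : R) := g (Num.max x 0).
have ch : continuous h by exact: continuous_max0.
have hE (x : R) : 0 <= x -> h x = g x by move=> x0; rewrite /h max_l.
pose mu := @lebesgue_measure R.
(* The integral starts at -1 so that 0 is an interior point of the domain where [G] has derivative
   [h]. *)
pose G x := (\int[mu]_(t in `[(-1 : R), x]) h t)%R.
have DG (x : R) : -1 < x -> is_derive x (1 : R) G (h x).
  move=> x1.
  have xx1 : x < x + 1 by rewrite ltrDl.
  have ih : mu.-integrable `[(-1), (x + 1)%R] (EFin \o h).
    apply: continuous_compact_integrable; first exact: segment_compact.
    exact: continuous_subspaceT.
  have [dG Gx] := continuous_FTC1_closed xx1 ih x1 (ch x).
  by apply: DeriveDef; [exact: dG | rewrite -derive1E; exact: Gx].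
have cG (x : R) : -1 < x -> {for x, continuous G}.
  move=> /DG [dG _].
  by apply: differentiable_continuous; exact/derivable1_diffP.
have m1 (x : R) : 0 <= x -> -1 < x by apply: lt_le_trans; rewrite ltrN10.
exists G; split=> [x x0|a b a0 b0]; first by apply: cG; exact: m1.
have mvt (u v : R) : 0 <= u -> u <= v ->
    exists2 w, w \in `[u, v] & G v - G u = h w * (v - u).
  move=> u0 uv; apply: MVT_segment => // [x|].
    rewrite in_itv/= => /andP[ux _]; apply: DG; apply: m1.
    exact: le_trans (ltW ux).
  apply: continuous_in_subspaceT => x.
  rewrite inE/= in_itv/= => /andP[ux _]; apply: cG; apply: m1.
  exact: le_trans ux.
have [ab|ba] := leP a b.
  have [w] := mvt _ _ a0 ab; rewrite in_itv/= => /andP[aw wb] ->.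
  have w0 := le_trans a0 aw.
  by rewrite hE// ler_wpM2r ?subr_ge0// ndg.
have [w] := mvt _ _ b0 (ltW ba); rewrite in_itv/= => /andP[bw wa].
rewrite hE ?(le_trans b0)// => E.
have : g b * (a - b) <= g w * (a - b).
  by rewrite ler_wpM2r ?subr_ge0 ?(ltW ba)// ndg.
by move: E; lra.
Qed.

Lemma cvg_bigsum (R : realType) (T : Type) (F : set_system T) {FF : Filter F}
    (I : Type) (r : seq I) (Q : pred I) (f : I -> T -> R) (l : I -> R) :
  (forall i, Q i -> f i x @[x --> F] --> l i) ->
  \sum_(i <- r | Q i) f i x @[x --> F] --> \sum_(i <- r | Q i) l i.
Proof.
move=> fl; elim: r => [|i r IH].
  have -> : (fun x => \sum_(i <- [::] | Q i) f i x) = (fun=> 0).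
    by apply/funext => x; rewrite big_nil.
  by rewrite big_nil; exact: cvg_cst.
have -> : (fun x => \sum_(j <- i :: r | Q j) f j x) =
    (fun x => (if Q i then f i x else 0) + \sum_(j <- r | Q j) f j x).
  by apply/funext => x; rewrite big_cons; case: ifP => //; rewrite add0r.
rewrite big_cons; case: ifPn => Qi.
  by apply: cvgD => //; exact: fl.
by rewrite -[X in _ --> X]add0r; apply: cvgD => //; exact: cvg_cst.
Qed.

Section Equilibrium.
Variables (R : realType) (E I P : finType).
Variables (od : P -> I) (pe : P -> seq E) (c : E -> R -> R).
Hypothesis pe_uniq : forall p, uniq (pe p).
Hypothesis od_surj : forall i, exists p, od p = i.
Hypothesis c_cont : forall e, {within `[0, +oo[, continuous (c e)}.
Hypothesis c_nd : forall e (x y : R), 0 <= x -> x <= y -> c e x <= c e y.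

Implicit Types (f g : flow R P) (m : I -> R).

Lemma load_ge0 f e : (forall p, 0 <= f p) -> 0 <= load pe f e.
Proof. by move=> f0; apply: sumr_ge0. Qed.

Lemma sum_flow m f : feasible od m f -> \sum_p f p = \sum_i m i.
Proof.
move=> [_ fm]; rewrite (partition_big od predT)//=.
by apply: eq_bigr => i _; rewrite fm.
Qed.

Lemma load_le m f e : feasible od m f -> load pe f e <= \sum_i m i.
Proof.
move=> ff; rewrite -(sum_flow ff) /load [leRHS](bigID [pred p | e \in pe p])/=.
by rewrite lerDl; apply: sumr_ge0 => p _; exact: ff.1.
Qed.

(** Exchange of the two sums; [load] counts a path once per edge, which matches the sum over the
    list [pe p] because that list has no repetition. *)
Lemma sum_load_cost f (C : E -> R) :
  \sum_e load pe f e * C e = \sum_p f p * \sum_(e <- pe p) C e.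
Proof.
under eq_bigr do rewrite /load mulr_suml big_mkcond/=.
rewrite exchange_big/=; apply: eq_bigr => p _.
rewrite -big_mkcond/= mulr_sumr -big_uniq//.
Qed.

(** Row vectors carry the topology in which boxes are compact, so the minimisation is done on
    them. *)
Definition flow_of_row (v : 'rV[R]_#|P|) : flow R P :=
  [ffun p => v ord0 (enum_rank p)].

Lemma flow_of_rowK f : flow_of_row (\row_j f (enum_val j)) = f.
Proof. by apply/ffunP => p; rewrite ffunE mxE enum_rankK. Qed.

(** Feasibility is a closed condition, and it bounds every coordinate by the total demand. *)
Lemma compact_feasible m :
  compact [set v | feasible od m (flow_of_row v)].
Proof.
pose B := \sum_i m i.
have ccoord p : continuous (fun v : 'rV[R]_#|P| => v ord0 (enum_rank p)).
  exact: coord_continuous.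
have cB : compact [set v : 'rV[R]_#|P| | forall j, `[0, B]%classic (v ord0 j)].
  by apply: (@rV_compact _ _ (fun=> `[0, B]%classic)) => j; exact: segment_compact.
apply: (subclosed_compact _ cB).
- rewrite (_ : mkset _ =
      (\bigcap_p ((fun v : 'rV[R]_#|P| => v ord0 (enum_rank p))
         @^-1` [set x | 0 <= x])) `&`
      (\bigcap_i ((fun v : 'rV[R]_#|P| =>
         \sum_(p | od p == i) v ord0 (enum_rank p)) @^-1` [set x | x = m i]))).
    apply: closedI; apply: closed_bigI => i _.
      apply: (continuous_closedP _).1; first exact: ccoord.
      exact: closed_ge.
    apply: (continuous_closedP _).1; last exact: closed_eq.
    by move=> v; apply: (@cvg_bigsum _ _ (nbhs v)) => p _; exact: ccoord.
  apply/seteqP; split=> v /=.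
    move=> [v0 vm]; split=> [p _ /=|i _ /=].
      by have := v0 p; rewrite ffunE.
    by rewrite -vm; apply: eq_bigr => p _; rewrite ffunE.
  move=> [v0 vm]; split=> [p|i]; first by rewrite ffunE; exact: v0.
  by rewrite -(vm i)//=; apply: eq_bigr => p _; rewrite ffunE.
- move=> v /= ff j; rewrite in_itv/=.
  have /(_ (enum_val j)) := ff.1; rewrite ffunE enum_valK => -> /=.
  rewrite /B -(sum_flow ff) (bigD1 (enum_val j))//= ffunE enum_valK lerDl.
  by apply: sumr_ge0 => p _; exact: ff.1.
Qed.

Lemma feasible_nonempty m : (forall i, 0 <= m i) -> exists f, feasible od m f.
Proof.
move=> m0; have [p0 p0P] := choice od_surj.
exists [ffun p => if p == p0 (od p) then m (od p) else 0]; split=> [p|i].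
  by rewrite ffunE; case: ifP.
rewrite (bigD1 (p0 i)) ?p0P//= ffunE p0P eqxx big1 ?addr0// => p /andP[/eqP <-].
by rewrite ffunE => /negbTE ->.
Qed.

Lemma potential_min m (G : E -> R -> R) : (forall i, 0 <= m i) ->
  (forall e (x : R), 0 <= x -> {for x, continuous (G e)}) ->
  exists2 f, feasible od m f & forall g, feasible od m g ->
    \sum_e G e (load pe f e) <= \sum_e G e (load pe g e).
Proof.
move=> m0 cG; have [f0 ff0] := feasible_nonempty m0.
set A := [set v | feasible od m (flow_of_row v)].
have A0 : A !=set0.
  by exists (\row_j f0 (enum_val j)); rewrite /A/= flow_of_rowK.
have cPhi : {within A, continuous
    (fun v => \sum_e G e (load pe (flow_of_row v) e))}.
  apply: continuous_in_subspaceT => v; rewrite inE => Av.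
  apply: (@cvg_bigsum _ _ (nbhs v) _ _ _ _ (fun e v => G e (load pe (flow_of_row v) e))
    (fun e => G e (load pe (flow_of_row v) e))) => e _.
  apply: (@cvg_comp _ _ _ (fun v => load pe (flow_of_row v) e) (G e)
    _ (nbhs (load pe (flow_of_row v) e))); last first.
    by apply: cG; apply: load_ge0; exact: Av.1.
  apply: (@cvg_bigsum _ _ (nbhs v)) => p _; rewrite ffunE.
  under eq_fun do rewrite ffunE.
  exact: coord_continuous.
have [v vA vmin] := compact_EVT_min A0 (@compact_feasible m) cPhi.
exists (flow_of_row v) => [|g fg]; first by move: vA; rewrite inE.
have := vmin (\row_j g (enum_val j)).
by rewrite flow_of_rowK; apply; rewrite inE /A/= flow_of_rowK.
Qed.

(** First-order condition at a minimiser of Beckmann's potential: shifting mass from a used path [p]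
    to [p'] changes the potential at the initial rate [pcost p' - pcost p], which therefore cannot
    be negative. *)
Lemma wardrop_eq_exists m : (forall i, 0 <= m i) ->
  exists f, wardrop_eq od pe c m f.
Proof.
move=> m0; have [G GP] := choice (fun e => convex_antiderivative (@c_cont e) (@c_nd e)).
have [f ff fmin] := potential_min m0 (fun e => (GP e).1).
exists f; split=> // p p' pp' fp.
(* Change of the load of [e] per unit of mass moved from [p] to [p']. *)
pose d e : R := (e \in pe p')%:R - (e \in pe p)%:R.
have dE (C : E -> R) :
    \sum_e C e * d e = \sum_(e <- pe p') C e - \sum_(e <- pe p) C e.
  have s q : \sum_(e <- pe q) C e = \sum_e C e * (e \in pe q)%:R.
    rewrite big_uniq//= big_mkcond/=; apply: eq_bigr => e _.
    by case: ifP; rewrite ?mulr1 ?mulr0.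
  by rewrite !s -sumrB; apply: eq_bigr => e _; rewrite mulrBr.
(* By convexity, moving mass [s] from [p] to [p'] raises the potential by at most [s * h s]. *)
pose h s := \sum_e c e (Num.max (load pe f e + s * d e) 0) * d e.
have h0 : h 0 = pcost pe c f p' - pcost pe c f p.
  rewrite -dE; apply: eq_bigr => e _; rewrite mul0r addr0 max_l//.
  by apply: load_ge0; exact: ff.1.
have ch : h s @[s --> 0^'+] --> h 0.
  apply: cvg_at_right_filter; apply: cvg_bigsum => e _.
  apply: cvgM; last exact: cvg_cst.
  apply: (@cvg_comp _ _ _ (fun s => load pe f e + s * d e)
    (fun x => c e (Num.max x 0)) _ (nbhs (load pe f e + 0 * d e))).
    by apply: cvgD; [exact: cvg_cst | apply: cvgMl; exact: cvg_id].
  exact: (continuous_max0 (@c_cont e)).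
rewrite -subr_ge0 -h0; apply: (cvgr_to_ge ch); near=> s.
have s0 : 0 < s by near: s; exact: nbhs_right_gt.
(* This keeps the shifted flow nonnegative on [p]. *)
have sf : s <= f p by near: s; exact: nbhs_right_le.
pose fs : flow R P := [ffun q => f q + s * ((q == p')%:R - (q == p)%:R)].
have ffs : feasible od m fs.
  split=> [q|i].
    rewrite ffunE; have f0 := ff.1 q.
    have [qp|_] := eqVneq q p; first by rewrite qp; case: eqP => _ /=; lra.
    by case: eqP => _ /=; lra.
  rewrite -(ff.2 i); under eq_bigr do rewrite ffunE.
  rewrite big_split/= -[RHS]addr0; congr (_ + _).
  rewrite -mulr_sumr sumrB -!natr_sum; apply/eqP; rewrite mulf_eq0; apply/orP; right.
  have cnt q : (\sum_(r | od r == i) (r == q) = (od q == i))%N.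
    rewrite big_mkcond/= (bigD1 q)//= eqxx big1 ?addn0 => [|r /negbTE ->].
      by case: ifP.
    by case: ifP.
  by rewrite !cnt pp' subrr.
have loads e : load pe fs e = load pe f e + s * d e.
  rewrite /load; under eq_bigr do rewrite ffunE.
  rewrite big_split/=; congr (_ + _).
  rewrite -mulr_sumr sumrB -!natr_sum; congr (_ * _).
  have cnt q : (\sum_(r | e \in pe r) (r == q) = (e \in pe q))%N.
    rewrite big_mkcond/= (bigD1 q)//= eqxx big1 ?addn0 => [|r /negbTE ->].
      by case: ifP.
    by case: ifP.
  by rewrite !cnt.
(* Minimality of [f], combined with the supporting line of each [G e] at the shifted load. *)
have : 0 <= \sum_e c e (load pe fs e) * (s * d e).
  apply: (@le_trans _ _ (\sum_e (G e (load pe fs e) - G e (load pe f e)))).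
    by rewrite sumrB subr_ge0; exact: fmin.
  apply: ler_sum => e _; have := (GP e).2 (load pe f e) (load pe fs e).
  rewrite [in X in _ -> _ -> _ <= X]loads (addrC (load pe f e)) addrK.
  rewrite (addrC (s * _)) -loads.
  by apply; apply: load_ge0; [exact: ff.1 | exact: ffs.1].
suff -> : \sum_e c e (load pe fs e) * (s * d e) = s * h s by rewrite pmulr_rge0.
rewrite mulr_sumr; apply: eq_bigr => e _; rewrite -loads max_l 1?mulrCA//.
by apply: load_ge0; exact: ffs.1.
Unshelve. all: by end_near. Qed.

(** With costs frozen at the equilibrium, [f] uses only cheapest paths of each OD pair, so both
    sides compare with [m i] times the cheapest path cost. *)
Lemma wardrop_variational m f g : wardrop_eq od pe c m f -> feasible od m g ->
  social_cost pe c f <= \sum_e load pe g e * c e (load pe f e).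
Proof.
move=> [ff fw] fg; rewrite /social_cost !sum_load_cost.
rewrite (partition_big od predT)//= [leRHS](partition_big od predT)//=.
apply: ler_sum => i _; have [p0 p0i] := od_surj i.
pose C p := \sum_(e <- pe p) c e (load pe f e).
have [q /eqP qi qmin] :=
  @arg_minP _ _ _ p0 (fun p => od p == i) C (introT eqP p0i).
apply: (@le_trans _ _ (m i * C q)).
  rewrite -(ff.2 i) mulr_suml; apply: ler_sum => p /eqP pi.
  have := ff.1 p; rewrite le_eqVlt => /predU1P[<-|fp]; first by rewrite !mul0r.
  by rewrite ler_pM2l// fw// pi.
rewrite -(fg.2 i) mulr_suml; apply: ler_sum => p pi.
by rewrite ler_wpM2l ?qmin//; exact: fg.1.
Qed.

End Equilibrium.

(** * Regular variation *)

(** Cauchy's functional equation: enclosing [n s] between consecutive integers gives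
    [n |A s - s A 1| <= A 1] for all [n], which forces the difference to vanish. *)
Lemma additive_nondecreasing_linear (R : realType) (A : R -> R) :
  {morph A : s u / s + u} -> {homo A : s u / s <= u} ->
  forall s, A s = s * A 1.
Proof.
move=> AD Amono.
have A0 : A 0 = 0 by have := AD 0 0; rewrite addr0; lra.
have AN s : A (- s) = - A s by have := AD s (- s); rewrite subrr A0; lra.
have AM n s : A (s *+ n) = A s *+ n.
  by elim: n => [|n IH]; rewrite ?mulr0n// !mulrS AD IH.
have A1 : 0 <= A 1 by rewrite -A0 Amono.
suff pos s : 0 <= s -> A s = s * A 1.
  move=> s; have [/pos//|s0] := leP 0 s.
  by rewrite -[s in LHS]opprK AN pos ?oppr_ge0 ?ltW// mulNr opprK.
move=> s0; apply/eqP; rewrite -subr_eq0; apply/negPn/negP => D0.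
have {D0}D0 : 0 < `|A s - s * A 1| by rewrite normr_gt0.
(* Large enough for [n] times the supposed discrepancy to exceed [A 1]. *)
pose n := (Num.truncn (A 1 / `|A s - s * A 1|)).+1.
have n0 : (0 : R) < n%:R by rewrite ltr0n.
have : A 1 < n%:R * `|A s - s * A 1|.
  rewrite -ltr_pdivrMr//.
  by have /andP[_] := truncn_itv (divr_ge0 A1 (ltW D0)).
apply/negP; rewrite -leNgt -(ger0_norm (ltW n0)) -normrM mulrBr mulr_natl -AM.
have /truncn_itv/andP[] : 0 <= s *+ n by rewrite mulrn_wge0.
set k := Num.truncn _ => ks sk.
have kA := Amono _ _ ks; have Ak := Amono _ _ (ltW sk).
have kE (j : nat) : A j%:R = j%:R * A 1 by rewrite AM mulr_natl.
rewrite !kE -natr1 mulrDl mul1r in kA Ak.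
have ks' : k%:R * A 1 <= n%:R * (s * A 1).
  by rewrite mulrA [_ * s]mulr_natl ler_wpM2r.
have sk' : n%:R * (s * A 1) <= k%:R * A 1 + A 1.
  by rewrite mulrA [_ * s]mulr_natl -[X in _ + X]mul1r -mulrDl natr1 ler_wpM2r// ltW.
by rewrite ler_norml; apply/andP; split; lra.
Qed.

Lemma powR_young (R : realType) (rho y z : R) : 0 <= rho -> 0 <= y -> 0 <= z ->
  (1 + rho) * (z * y `^ rho) <= rho * y `^ (1 + rho) + z `^ (1 + rho).
Proof.
move=> rho0 y0 z0; have r1 : 0 < 1 + rho by rewrite ltr_wpDr.
(* For [rho = 0] the conjugate exponent [(1 + rho) / rho] degenerates, and the claim is an
   equality. *)
have [->|rhoN0] := eqVneq rho 0.
  by rewrite powRr0 addr0 !mul1r mulr1 mul0r add0r powRr1.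
have rhop : 0 < rho by rewrite lt_neqAle eq_sym rhoN0.
have r1N : 1 + rho != 0 by rewrite gt_eqF.
have q0 : 0 < (1 + rho) / rho by rewrite divr_gt0.
have pq : (1 + rho)^-1 + ((1 + rho) / rho)^-1 = 1.
  by rewrite invfM invrK; field; rewrite ?rhoN0 ?r1N.
have := conjugate_powR z0 (powR_ge0 y rho) r1 q0 pq.
rewrite -powRrM (mulrC rho) divfK// => /(ler_wpM2l (ltW r1)) /le_trans; apply.
rewrite le_eqVlt; apply/orP; left; apply/eqP.
by field; rewrite ?rhoN0 ?r1N.
Qed.

Lemma powRS (R : realType) (rho y : R) : 0 <= rho -> 0 <= y ->
  y `^ (1 + rho) = y * y `^ rho.
Proof.
move=> rho0 y0; rewrite powRD ?powRr1//.
by rewrite gt_eqF// ltr_wpDr.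
Qed.

(** Young's inequality with [y := z] and [z := w] bounds the difference by
    [(1 + rho) (z - w) z^rho], and [z^rho <= 1]. *)
Lemma powR_lipschitz (R : realType) (rho w z : R) :
  0 <= rho -> 0 <= w -> w <= z -> z <= 1 ->
  z `^ (1 + rho) - w `^ (1 + rho) <= (1 + rho) * (z - w).
Proof.
move=> rho0 w0 wz z1; have z0 := le_trans w0 wz.
have := powR_young rho0 z0 w0; rewrite (powRS rho0 z0).
have p1 : z `^ rho <= 1 by rewrite -[leRHS](congr1 (fun f => f rho) (powR1 R)) ge0_ler_powR ?nnegrE.
have : (1 + rho) * (z - w) * z `^ rho <= (1 + rho) * (z - w).
  by rewrite ler_piMr// mulr_ge0 ?subr_ge0// addr_ge0.
lra.
Qed.

(* Polya's theorem: monotonicity upgrades pointwise to uniform convergence. *)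
Lemma monotone_uniform_cvg (R : realType) (T : Type) (F : set_system T)
    {FF : Filter F} (H : T -> R -> R) (G : R -> R) (L : R) :
  (\forall t \near F, forall x y, 0 <= x -> x <= y -> y <= 1 -> H t x <= H t y) ->
  (forall y, 0 <= y <= 1 -> H t y @[t --> F] --> G y) ->
  0 <= L ->
  (forall x y, 0 <= x -> x <= y -> y <= 1 ->
    0 <= G y - G x <= L * (y - x)) ->
  forall eps, 0 < eps ->
    \forall t \near F, forall y, 0 <= y <= 1 -> `|H t y - G y| <= eps.
Proof.
move=> Hmono HG L0 GL eps eps0.
have e2 : 0 < eps / 2 by rewrite divr_gt0.
(* [G] varies by at most [eps / 2] over one cell of the grid of mesh [1 / N]. *)
pose N := (Num.truncn (L / (eps / 2))).+1.
have N0 : (0 : R) < N%:R by rewrite ltr0n.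
have LN : L / N%:R <= eps / 2.
  rewrite ler_pdivrMr// mulrC -ler_pdivrMr//.
  by have /andP[_ /ltW] := truncn_itv (divr_ge0 L0 (ltW e2)).
have near_grid : \forall t \near F, forall i : 'I_N.+1,
    `|H t (i%:R / N%:R) - G (i%:R / N%:R)| <= eps / 2.
  apply: filter_forall => i; have : 0 <= (i%:R / N%:R : R) <= 1.
    rewrite divr_ge0//= ler_pdivrMr// mul1r ler_nat.
    by rewrite -ltnS ltn_ord.
  by move=> /HG /cvgrPdistC_le; apply.
near=> t => y /andP[y0 y1].
have mono : forall x y, 0 <= x -> x <= y -> y <= 1 -> H t x <= H t y.
  by near: t.
have grid : forall i : 'I_N.+1,
    `|H t (i%:R / N%:R) - G (i%:R / N%:R)| <= eps / 2 by near: t.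
have gridn (i : nat) : (i <= N)%N ->
    `|H t (i%:R / N%:R) - G (i%:R / N%:R)| <= eps / 2.
  by rewrite -ltnS => iN; exact: (grid (Ordinal iN)).
(* The endpoint 1 is itself a grid point with no cell to its right. *)
have [y1'|y1'] := ltP y 1; last first.
  have -> : y = N%:R / N%:R by rewrite divff ?gt_eqF//; lra.
  by apply: (le_trans (gridn _ (leqnn _))); lra.
have yN0 : 0 <= y * N%:R by rewrite mulr_ge0// ltW.
have /andP[] := truncn_itv yN0; set i := Num.truncn _ => iy yi.
have iN : (i < N)%N.
  by rewrite -(ltr_nat R) (le_lt_trans iy)// gtr_pMl.
have {}iy : i%:R / N%:R <= y by rewrite ler_pdivrMr.
have {}yi : y <= i.+1%:R / N%:R by rewrite ler_pdivlMr// ltW.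
have i0 : 0 <= (i%:R / N%:R : R) by rewrite divr_ge0.
have i1 : (i.+1%:R / N%:R : R) <= 1 by rewrite ler_pdivrMr// mul1r ler_nat.
have step : (i.+1%:R / N%:R : R) = i%:R / N%:R + N%:R^-1.
  by rewrite -natr1 mulrDl mul1r.
have g1 := gridn _ (ltnW iN); have g2 := gridn _ iN.
have m1 := mono _ _ i0 iy y1; have m2 := mono _ _ y0 yi i1.
have /andP[l1 l2] := GL _ _ i0 iy y1; have /andP[l3 l4] := GL _ _ y0 yi i1.
have b1 : L * (y - i%:R / N%:R) <= L / N%:R.
  by rewrite ler_wpM2l//; lra.
have b2 : L * (i.+1%:R / N%:R - y) <= L / N%:R.
  by rewrite ler_wpM2l//; lra.
move: g1 g2; rewrite !ler_norml => /andP[g1 g1'] /andP[g2 g2'].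
by apply/andP; split; lra.
Unshelve. all: by end_near. Qed.

Section RegularVariation.
Variables (R : realType) (F : set_system R) (cb : R -> R).
Context {FF : ProperFilter F}.
Hypothesis F_gt0 : \forall t \near F, 0 < t.
Hypothesis F_scale : forall x : R, 0 < x -> t * x @[t --> F] --> F.
Hypothesis cb_gt0 : forall t : R, 0 < t -> 0 < cb t.

(** Factor the quotient as [k (t x) / cb (t x)] times [cb (t x) / cb t]. Working with any
    scale-invariant filter [F] treats both values of omega at once. *)
Lemma cvg_div_scale (k : R -> R) (a x l : R) : 0 < x ->
  k t / cb t @[t --> F] --> a -> cb (t * x) / cb t @[t --> F] --> l ->
  k (t * x) / cb t @[t --> F] --> a * l.
Proof.
move=> x0 ka xl; have kx := cvg_comp _ _ (F_scale x0) ka.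
apply: cvg_trans (cvgM kx xl); apply: near_eq_cvg; near=> t.
rewrite /= mulrA divfK// gt_eqF// cb_gt0// mulr_gt0//.
by near: t.
Unshelve. all: by end_near. Qed.

(** The limit function [l] is multiplicative and inherits monotonicity from [k], because
    [k (t x) / cb t] tends to [a * l x] with [a > 0]. Conjugating by [expR] and [ln] makes it
    additive, hence linear. *)
Lemma regular_variation_index (k : R -> R) (a : R) :
  (forall x : R, 0 < x -> exists l : R, l != 0 /\
    cb (t * x) / cb t @[t --> F] --> l) ->
  (forall x y : R, 0 <= x -> x <= y -> k x <= k y) ->
  k t / cb t @[t --> F] --> a -> 0 < a ->
  exists2 rho, 0 <= rho & forall x : R, 0 < x ->
    cb (t * x) / cb t @[t --> F] --> x `^ rho.
Proof.
move=> rv knd ka a0.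
(* [l] takes the junk value 0 at nonpositive arguments. *)
have /choice[l lP] : forall x : R, exists l, 0 < x -> l != 0 /\
    cb (t * x) / cb t @[t --> F] --> l.
  move=> x; have [x0|x0] := ltP 0 x; last by exists 0.
  by have [l ?] := rv x x0; exists l.
have lc x x0 := (lP x x0).2.
have l_gt0 x : 0 < x -> 0 < l x.
  move=> x0; have [lN0 xl] := lP x x0; rewrite lt_neqAle eq_sym lN0/=.
  apply: (cvgr_to_ge xl); near=> t.
  have t0 : 0 < t by near: t.
  by rewrite divr_ge0 ?ltW ?cb_gt0 ?mulr_gt0.
have lM x y : 0 < x -> 0 < y -> l (x * y) = l y * l x.
  move=> x0 y0; have xy0 := mulr_gt0 x0 y0.
  have ylx := @cvg_div_scale (fun t => cb (t * y)) _ x _ x0 (lc y y0) (lc x x0).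
  have xyl := lc _ xy0.
  have e : (fun t => cb (t * (x * y)) / cb t) = (fun t => cb (t * x * y) / cb t).
    by apply/funext => t; rewrite mulrA.
  rewrite e in xyl; exact: (@cvg_unique _ (@Rhausdorff R) _ _ _ _ xyl ylx).
have lmono x y : 0 < x -> x <= y -> l x <= l y.
  move=> x0 xy; have y0 := lt_le_trans x0 xy.
  have cx := cvg_div_scale x0 ka (lc x x0).
  have cy := cvg_div_scale y0 ka (lc y y0).
  rewrite -(ler_pM2l a0); apply: (ler_cvg_to cx cy); near=> t.
  have t0 : 0 < t by near: t.
  rewrite ler_pM2r ?invr_gt0 ?cb_gt0//.
  by apply: knd; rewrite ?ler_pM2l// mulr_ge0 ?(ltW x0) ?(ltW t0).
pose A s := ln (l (expR s)).
have AD : {morph A : s u / s + u}.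
  move=> s u; rewrite /A expRD lM ?expR_gt0// lnM ?posrE ?l_gt0 ?expR_gt0//.
  by rewrite addrC.
have Amono : {homo A : s u / s <= u}.
  move=> s u su; rewrite /A ler_ln ?posrE ?l_gt0 ?expR_gt0//.
  by rewrite lmono ?expR_gt0// ler_expR.
have Alin := additive_nondecreasing_linear AD Amono.
exists (A 1); first by have := Amono 0 1 ler01; rewrite Alin mul0r.
move=> x x0; suff -> : x `^ A 1 = l x by exact: lc.
rewrite /powR gt_eqF// mulrC -Alin /A.
have -> : expR (ln x) = x by rewrite lnK ?posrE.
by rewrite lnK ?posrE ?l_gt0.
Unshelve. all: by end_near. Qed.

Variable rho : R.
Hypothesis rho_ge0 : 0 <= rho.
Hypothesis cb_rho : forall x : R, 0 < x -> cb (t * x) / cb t @[t --> F] --> x `^ rho.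

(** The factor [y] makes both terms vanish at [y = 0], where [cb_rho] says nothing, and keeps the
    rescaled cost monotone; its limit is Lipschitz on [0,1] with constant [a (1 + rho)]. *)
Lemma edge_cost_uniform (k : R -> R) (a : R) :
  (forall x : R, 0 <= x -> 0 <= k x) ->
  (forall x y : R, 0 <= x -> x <= y -> k x <= k y) ->
  k t / cb t @[t --> F] --> a ->
  forall eps, 0 < eps -> \forall t \near F, forall y, 0 <= y <= 1 ->
    `|y * (k (t * y) / cb t) - a * y `^ (1 + rho)| <= eps.
Proof.
move=> k0 knd ka; have r1 : 0 < 1 + rho by rewrite ltr_wpDr.
have a0 : 0 <= a.
  apply: (cvgr_to_ge ka); near=> t; have t0 : 0 < t by near: t.
  by rewrite divr_ge0 ?k0 ?ltW ?cb_gt0.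
apply: (@monotone_uniform_cvg _ _ _ _ _ _ (a * (1 + rho))).
- near=> t => x y x0 xy y1; have t0 : 0 < t by near: t.
  have y0 := le_trans x0 xy.
  have tx : 0 <= t * x by rewrite mulr_ge0// ltW.
  rewrite ler_pM//; first by rewrite divr_ge0 ?k0// ltW// cb_gt0.
  by rewrite ler_pM2r ?invr_gt0 ?cb_gt0// knd// ler_pM2l.
- move=> y /andP[y0 y1]; move: y0; rewrite le_eqVlt => /predU1P[<-|y0].
    under eq_fun do rewrite mul0r.
    by rewrite powR0 ?gt_eqF// mulr0; exact: cvg_cst.
  have -> : a * y `^ (1 + rho) = y * (a * y `^ rho).
    by rewrite (powRS rho_ge0 (ltW y0)) mulrCA.
  apply: cvgMl_tmp.
  by apply: cvg_div_scale => //; exact: cb_rho.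
- by rewrite mulr_ge0// ltW.
- move=> x y x0 xy y1; have y0 := le_trans x0 xy.
  rewrite -mulrBr mulr_ge0//=; last first.
    by rewrite subr_ge0 ge0_ler_powR ?nnegrE// ltW.
  by rewrite -mulrA ler_wpM2l// powR_lipschitz.
Unshelve. all: by end_near. Qed.

Lemma edge_cost_lower (k : R -> R) (a x : R) : 0 < x -> 0 < a ->
  k t / cb t @[t --> F] --> a ->
  exists2 b, 0 < b & \forall t \near F, b <= k (t * x) / cb t.
Proof.
move=> x0 a0 ka; have l0 : 0 < a * x `^ rho by rewrite mulr_gt0// powR_gt0.
exists (a * x `^ rho / 2); first by rewrite divr_gt0.
have /cvgr_gt := cvg_div_scale x0 ka (cb_rho x0).
move=> /(_ (a * x `^ rho / 2)) h.
have /h : a * x `^ rho / 2 < a * x `^ rho by lra.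
by apply: filterS => t /ltW.
Qed.

(** The factor [cb (t x) / cb t] eventually exceeds half its limit [x^rho], and the other factor
    grows beyond every bound. *)
Lemma edge_cost_infinite (k : R -> R) (x K : R) : 0 < x -> 0 <= K ->
  (forall B, \forall t \near F, B <= k t / cb t) ->
  \forall t \near F, K <= k (t * x) / cb t.
Proof.
move=> x0 K0 kinf; have l0 : 0 < x `^ rho by rewrite powR_gt0.
have l2 : 0 < x `^ rho / 2 by rewrite divr_gt0.
have Cnear : \forall t \near F, x `^ rho / 2 < cb (t * x) / cb t.
  have /cvgr_gt := cb_rho x0; apply; lra.
near=> t; have t0 : 0 < t by near: t.
have tx0 : 0 < t * x by rewrite mulr_gt0.
have B : K / (x `^ rho / 2) <= k (t * x) / cb (t * x).
  near: t; exact: (F_scale x0 (kinf (K / (x `^ rho / 2)))).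
have C : x `^ rho / 2 <= cb (t * x) / cb t by apply: ltW; near: t.
have -> : k (t * x) / cb t = k (t * x) / cb (t * x) * (cb (t * x) / cb t).
  by rewrite mulrA divfK// gt_eqF// cb_gt0.
apply: le_trans (ler_pM _ _ B C); first by rewrite divfK// gt_eqF.
  by rewrite divr_ge0// ltW.
exact: ltW.
Unshelve. all: by end_near. Qed.

End RegularVariation.

(** * Comparing an equilibrium with a near-optimal flow *)

(* Young's inequality bounds the cross term [z k(y)] of the variational inequality by the costs at [y] and [z]; passing to [max(y, delta)] keeps [k] away from 0, where [k] need not be close to its limit. *)
Lemma cross_cost_le (R : realType) (k : R -> R) (a rho eps delta y w z : R) :
  (forall u v : R, 0 <= u -> u <= v -> k u <= k v) ->
  0 <= a -> 0 <= rho -> 0 < eps -> 0 < delta <= 1 ->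
  0 <= y <= 1 -> 0 <= w <= 1 -> 0 <= z <= 1 -> z <= w + delta ->
  (forall u, 0 <= u <= 1 -> `|u * k u - a * u `^ (1 + rho)| <= eps) ->
  (1 + rho) * (z * k y) <= rho * (y * k y) + w * k w +
    ((1 + rho) * (eps + eps / delta) + a * (1 + rho) ^+ 2 * delta).
Proof.
move=> knd a0 rho0 eps0 /andP[d0 d1] /andP[y0 y1] /andP[w0 w1] /andP[z0 z1] zw.
move=> unif; have r0 : 0 < 1 + rho by rewrite ltr_wpDr.
pose t := Num.max y delta.
have [yt dt] : y <= t /\ delta <= t by rewrite !le_max !lexx orbT.
have t1 : t <= 1 by rewrite ge_max y1.
have t0 : 0 < t := lt_le_trans d0 dt.
(* Dividing the uniform estimate by [t >= delta] costs [eps / delta]. *)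
have kt : k t <= a * t `^ rho + eps / delta.
  have : t * k t <= t * (a * t `^ rho + eps / t).
    have -> : t * (a * t `^ rho + eps / t) = a * t `^ (1 + rho) + eps.
      by rewrite (powRS rho0 (ltW t0)); field; rewrite gt_eqF.
    have := unif t; rewrite ltW// t1 => /(_ isT); rewrite ler_norml => /andP[_].
    lra.
  rewrite ler_pM2l// => /le_trans; apply.
  by rewrite lerD2l ler_pM2l// lef_pV2.
have zk : z * k y <= a * (z * t `^ rho) + eps / delta.
  apply: (@le_trans _ _ (z * (a * t `^ rho + eps / delta))).
    by rewrite ler_wpM2l// (le_trans _ kt)// knd.
  by rewrite mulrDr mulrCA lerD2l ler_piMl// divr_ge0 ?ltW.
have young := powR_young rho0 (ltW t0) z0.
have ty : t `^ (1 + rho) <= y `^ (1 + rho) + (1 + rho) * delta.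
  have := powR_lipschitz rho0 y0 yt t1.
  have : (1 + rho) * (t - y) <= (1 + rho) * delta.
    by rewrite ler_pM2l// lerBlDr /t ge_max lerDr lerDl y0 ltW.
  lra.
have zw' : z `^ (1 + rho) <= w `^ (1 + rho) + (1 + rho) * delta.
  have rd : 0 <= (1 + rho) * delta by rewrite mulr_ge0// ltW.
  have [wz|zw'] := leP w z; last first.
    have : z `^ (1 + rho) <= w `^ (1 + rho).
      by rewrite ge0_ler_powR ?nnegrE// ltW.
    lra.
  have := powR_lipschitz rho0 w0 wz z1.
  have : (1 + rho) * (z - w) <= (1 + rho) * delta.
    by rewrite ler_pM2l//; lra.
  lra.
have uy : a * y `^ (1 + rho) <= y * k y + eps.
  have := unif y; rewrite y0 y1 => /(_ isT); rewrite ler_norml => /andP[+ _].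
  lra.
have uw : a * w `^ (1 + rho) <= w * k w + eps.
  have := unif w; rewrite w0 w1 => /(_ isT); rewrite ler_norml => /andP[+ _].
  lra.
have := ler_wpM2l (ltW r0) zk; have := ler_wpM2l a0 young.
have := ler_wpM2l (mulr_ge0 a0 rho0) ty; have := ler_wpM2l a0 zw'.
have := ler_wpM2l rho0 uy.
by move: uw; rewrite expr2; lra.
Qed.

Section Estimates.
Variables (R : realType) (E I P : finType).
Variables (od : P -> I) (pe : P -> seq E) (c : E -> R -> R).
Hypothesis pe_uniq : forall p, uniq (pe p).
Hypothesis od_surj : forall i, exists p, od p = i.
Hypothesis c_ge0 : forall e (x : R), 0 <= x -> 0 <= c e x.
Hypothesis c_nd : forall e (x y : R), 0 <= x -> x <= y -> c e x <= c e y.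

Implicit Types (f g w z : flow R P) (m : I -> R).

Lemma social_cost_edge_ge m w e x : feasible od m w -> 0 <= x ->
  x <= load pe w e -> x * c e x <= social_cost pe c w.
Proof.
move=> fw x0 xw; have l0 e' : 0 <= load pe w e' by apply: load_ge0; exact: fw.1.
rewrite /social_cost (bigD1 e)//= -[leLHS]addr0 lerD ?ler_pM ?c_ge0 ?c_nd//.
by apply: sumr_ge0 => e' _; rewrite mulr_ge0 ?c_ge0.
Qed.

Lemma social_cost_ge0 m w : feasible od m w -> 0 <= social_cost pe c w.
Proof.
move=> fw; apply: sumr_ge0 => e _.
have l0 : 0 <= load pe w e by apply: load_ge0; exact: fw.1.
by rewrite mulr_ge0 ?c_ge0.
Qed.

Lemma Opt_le m w : feasible od m w -> Opt od pe c m <= social_cost pe c w.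
Proof.
move=> fw; apply: ge_inf; last by exists w.
by exists 0 => _ [g fg <-]; exact: social_cost_ge0 fg.
Qed.

(** [Opt] is encoded as an infimum; a flow within [tau] of it plays the part of an optimal flow. *)
Lemma Opt_approx m tau : (forall i, 0 <= m i) -> 0 < tau ->
  exists2 w, feasible od m w & social_cost pe c w < Opt od pe c m + tau.
Proof.
move=> m0 tau0; have [g fg] := feasible_nonempty od_surj m0.
have [|_ [w fw <-] wO] := @inf_adherent _ [set social_cost pe c g | g in feasible od m] _ tau0.
  split; first by exists (social_cost pe c g), g.
  by exists 0 => _ [h fh <-]; exact: social_cost_ge0 fh.
by exists w.
Qed.

Lemma Eq_wardrop m : (exists f, wardrop_eq od pe c m f) ->
  exists2 f, wardrop_eq od pe c m f & Eq od pe c m = social_cost pe c f.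
Proof.
move=> [f fw]; exists (xget (0 : flow R P) [set f | wardrop_eq od pe c m f]) => //.
exact: (@xgetPex _ (0 : flow R P) [set f | wardrop_eq od pe c m f] (ex_intro _ f fw)).
Qed.

Variable fin : pred E.
Variable p0 : I -> P.
Hypothesis od_p0 : forall i, od (p0 i) = i.
Hypothesis p0_fin : forall i, all fin (pe (p0 i)).

(** Each OD pair sends the flow of its bad paths to [p0 i]. A bad path carries at most [d], since it
    crosses an edge outside [fin]. So each OD pair moves at most [#|P| d], and at most [#|P|] paths
    through an edge receive such an amount. *)
Lemma reroute m w d : feasible od m w ->
  (forall e, ~~ fin e -> load pe w e <= d) -> 0 <= d ->
  exists z, [/\ feasible od m z, (forall e, ~~ fin e -> load pe z e = 0) &
    forall e, load pe z e <= load pe w e + (#|P| ^ 2)%:R * d].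
Proof.
move=> fw wd d0; pose good p := all fin (pe p).
pose S i := \sum_(q | (od q == i) && ~~ good q) w q.
have S0 i : 0 <= S i by apply: sumr_ge0 => q _; exact: fw.1.
have Sd i : S i <= #|P|%:R * d.
  rewrite mulr_natl -sumr_const /S big_mkcond/=; apply: ler_sum => q _.
  case: ifP => // /andP[_]; rewrite -has_predC => /hasP[e eq /= efin].
  apply: le_trans (wd _ efin); rewrite /load (bigD1 q)//= lerDl.
  by apply: sumr_ge0 => r _; exact: fw.1.
pose z : flow R P := [ffun p => (if good p then w p else 0) +
  (if p == p0 (od p) then S (od p) else 0)].
exists z; split.
- split=> [p|i].
    rewrite ffunE addr_ge0//; case: ifP => // _; exact: fw.1.
  under eq_bigr do rewrite ffunE.
  rewrite big_split/= -(fw.2 i) [RHS](bigID good)/=; congr (_ + _).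
    by rewrite -big_mkcondr.
  rewrite (bigD1 (p0 i)) ?od_p0//= eqxx big1 ?addr0// => p /andP[/eqP <-].
  by move=> /negbTE ->.
- move=> e efin; apply: big1 => p ep; rewrite ffunE.
  have badp : good p = false by apply/negP => /allP/(_ _ ep); exact/negP.
  rewrite badp add0r; case: eqP => // pp.
  by have := p0_fin (od p); rewrite -pp -/(good p) badp.
- move=> e; rewrite /load; under eq_bigr do rewrite ffunE.
  rewrite big_split/= lerD//.
    by apply: ler_sum => p _; case: ifP => // _; exact: fw.1.
  rewrite expnS expn1 natrM -mulrA mulr_natl -sumr_const big_mkcond/=.
  apply: ler_sum => p _; have Pd : 0 <= #|P|%:R * d by rewrite mulr_ge0.
  by case: ifP => //; case: ifP.
Qed.

Variables (m : I -> R) (s : R).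
Let M := \sum_i m i.
Hypothesis m_ge0 : forall i, 0 <= m i.
Hypothesis M_gt0 : 0 < M.
Hypothesis s_gt0 : 0 < s.

Let load_share f e : feasible od m f -> 0 <= load pe f e / M <= 1.
Proof.
move=> ff; rewrite divr_ge0 ?(ltW M_gt0)//=; last by apply: load_ge0; exact: ff.1.
by rewrite ler_pdivrMr// mul1r; exact: load_le ff.
Qed.

(** Here [s] stands for [cb M], so [M * s] is the natural unit of social cost. A flow confined to
    [fin] edges has loads at most [M]. *)
Lemma Opt_upper (K : E -> R) : (forall e, fin e -> c e M / s <= K e) ->
  Opt od pe c m <= (\sum_(e | fin e) K e) * (M * s).
Proof.
move=> cK; have [g fg] := feasible_nonempty od_surj m_ge0.
(* The crude bound [d = M] suffices: only confinement to [fin] is wanted. *)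
have [|z [fz z0 _]] := reroute fg _ (ltW M_gt0); first by move=> e _; exact: load_le fg.
apply: (le_trans (Opt_le fz)); rewrite /social_cost (bigID fin)/= addrC big1; last first.
  by move=> e /z0 ->; rewrite mul0r.
rewrite add0r mulr_suml; apply: ler_sum => e /cK.
rewrite ler_pdivrMr// => cM; have l0 : 0 <= load pe z e by apply: load_ge0; exact: fz.1.
have lM : load pe z e <= M by exact: load_le fz.
rewrite mulrCA; apply: ler_pM => //; first exact: c_ge0.
by apply: le_trans cM; exact: c_nd.
Qed.

(** By pigeonhole, some path of a [posI] pair carries a share at least [gam / (#|P| + 1)], and one
    of its edges is in [posE]; that edge alone pays the bound. *)
Lemma Opt_lower (posE : pred E) (posI : pred I) gam b :
  (forall p, posI (od p) -> exists2 e, e \in pe p & posE e) ->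
  0 < gam -> gam <= \sum_(i | posI i) m i / M ->
  (forall e, posE e -> b <= c e (M * (gam / #|P|.+1%:R)) / s) ->
  gam / #|P|.+1%:R * b * (M * s) <= Opt od pe c m.
Proof.
move=> pospath gam0 gamI bc; set eta := gam / _ in bc *.
have eta0 : 0 < eta by rewrite divr_gt0.
have [g0 fg0] := feasible_nonempty od_surj m_ge0.
apply: lb_le_inf; first by exists (social_cost pe c g0), g0.
move=> _ [w fw <-].
(* Otherwise [gam M <= #|P| eta M], which is less than [gam M] thanks to the successor in the
   denominator. *)
have [p pI pw] : exists2 p, posI (od p) & eta * M <= w p.
  apply/not_exists2P => h.
  have : gam * M <= #|P|%:R * (eta * M).
    apply: (@le_trans _ _ (\sum_(p | posI (od p)) w p)).
      rewrite (partition_big od posI)//=.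
      move: gamI; rewrite -mulr_suml ler_pdivlMr// => /le_trans; apply.
      apply: ler_sum => i Ii; rewrite -(fw.2 i) le_eqVlt; apply/orP; left.
      by apply/eqP; apply: eq_bigl => p; case: eqP => [->|]; rewrite ?Ii ?andbF.
    rewrite [leRHS]mulr_natl -sumr_const big_mkcond/=; apply: ler_sum => p _.
    case: ifP => // [pI|_]; last by rewrite mulr_ge0// ltW.
    by case: (h p) => // /negP; rewrite -ltNge => /ltW.
  rewrite mulrA ler_pM2r// /eta mulrCA ler_pMr//.
  by rewrite ler_pdivlMr// mul1r ler_nat ltnn.
have [e ep eE] := pospath _ pI.
have xw : M * eta <= load pe w e.
  rewrite mulrC (le_trans pw)// /load (bigD1 p)//= lerDl.
  by apply: sumr_ge0 => q _; exact: fw.1.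
have x0 : 0 <= M * eta by rewrite mulr_ge0 ?ltW.
apply: le_trans (social_cost_edge_ge fw x0 xw).
have := bc e eE; rewrite ler_pdivlMr// => bs.
have -> : eta * b * (M * s) = M * eta * (b * s) by ring.
by rewrite ler_wpM2l.
Qed.

(** Apply [cross_cost_le] edge by edge to the equilibrium [f], the competitor [w] and its rerouting
    [z]; summing and inserting the variational inequality, [rho] times the equilibrium cost
    cancels. *)
Lemma Eq_le_approx (a : E -> R) rho eps delta f w :
  (forall e, fin e -> 0 <= a e) -> 0 <= rho -> 0 < eps -> 0 < delta <= 1 ->
  (forall e, fin e -> forall u, 0 <= u <= 1 ->
    `|u * (c e (M * u) / s) - a e * u `^ (1 + rho)| <= eps) ->
  wardrop_eq od pe c m f -> feasible od m w ->
  (forall e, ~~ fin e -> load pe w e <= M * (delta / (#|P| ^ 2).+1%:R)) ->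
  social_cost pe c f <= social_cost pe c w +
    (#|E|%:R * ((1 + rho) * (eps + eps / delta)) +
     (\sum_(e | fin e) a e) * ((1 + rho) ^+ 2 * delta)) * (M * s).
Proof.
move=> a0 rho0 eps0 dd unif fW fw wd; have ff := fW.1; have /andP[d0 d1] := dd.
(* With this bound on the forbidden edges, rerouting raises each load share by at most [delta]. *)
have D0 : 0 <= M * (delta / (#|P| ^ 2).+1%:R) by rewrite mulr_ge0 ?divr_ge0 ?ltW.
have [z [fz z0 zw]] := reroute fw wd D0.
have vi := wardrop_variational pe_uniq od_surj fW fz.
have r0 : 0 < 1 + rho by rewrite ltr_wpDr.
pose phi e u := c e (M * u) / s.
have phiE g e h : load pe g e * c e (load pe h e) =
    load pe g e / M * phi e (load pe h e / M) * (M * s).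
  rewrite /phi [M * (_ / M)]mulrC divfK ?gt_eqF//.
  by field; rewrite ?gt_eqF.
pose err e := (1 + rho) * (eps + eps / delta) + a e * (1 + rho) ^+ 2 * delta.
have Ms : 0 <= M * s by rewrite mulr_ge0 ?ltW.
(* Outside [fin] the left side is zero, because [z] avoids those edges. *)
have key e : (1 + rho) * (load pe z e * c e (load pe f e)) <=
    rho * (load pe f e * c e (load pe f e)) + load pe w e * c e (load pe w e) +
    (if fin e then err e else 0) * (M * s).
  have l0 g : feasible od m g -> 0 <= load pe g e by move=> fg; apply: load_ge0; exact: fg.1.
  case: ifPn => efin; last first.
    rewrite z0// mul0r mulr0 mul0r addr0 addr_ge0//.
      by rewrite !mulr_ge0 ?c_ge0 ?l0.
    by rewrite mulr_ge0 ?c_ge0 ?l0.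
  rewrite !phiE.
  set y := load pe f e / M; set z' := load pe z e / M; set w' := load pe w e / M.
  suff /(ler_wpM2r Ms) : (1 + rho) * (z' * phi e y) <=
      rho * (y * phi e y) + w' * phi e w' + err e.
    by set K1 := phi e y; set K2 := phi e w'; lra.
  apply: cross_cost_le; rewrite ?a0 ?load_share//.
  - move=> u v u0 uv; rewrite /phi ler_pM2r ?invr_gt0// c_nd ?ler_pM2l//.
    by rewrite mulr_ge0// ltW.
  - rewrite ler_pdivrMr// mulrDl divfK ?gt_eqF//; apply: (le_trans (zw e)).
    rewrite lerD2l mulrCA mulrC ler_pM2r// mulrCA ger_pMr//.
    by rewrite ler_pdivrMr// mul1r ler_nat.
  - exact: unif.
have tot : (1 + rho) * \sum_e load pe z e * c e (load pe f e) <=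
    rho * social_cost pe c f + social_cost pe c w +
    (\sum_(e | fin e) err e) * (M * s).
  rewrite [X in _ + X * _]big_mkcond/= mulr_suml /social_cost !mulr_sumr.
  by rewrite -!big_split/=; exact: ler_sum.
have : \sum_(e | fin e) err e <=
    #|E|%:R * ((1 + rho) * (eps + eps / delta)) +
     (\sum_(e | fin e) a e) * ((1 + rho) ^+ 2 * delta).
  rewrite big_split/= lerD//.
    rewrite sumr_const [leRHS]mulr_natl ler_wpMn2l ?max_card//.
    by rewrite ltW// mulr_gt0// addr_gt0// divr_gt0.
  by rewrite mulr_suml; apply: ler_sum => e _; rewrite -mulrA.
move=> /(ler_wpM2r Ms); have := ler_wpM2l (ltW r0) vi; move: tot; lra.
Qed.

End Estimates.

(** * The limit omega and the constants alpha *)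

Section OmegaNbhs.
Variables (R : realType) (omega_inf : bool).
Local Notation F := (@omega_nbhs R omega_inf).

Lemma omega_nbhs_proper : ProperFilter F.
Proof.
rewrite /omega_nbhs; case: omega_inf; first exact: proper_pinfty_nbhs.
exact: at_right_proper_filter.
Qed.

Lemma omega_nbhs_gt0 : \forall t \near F, 0 < t.
Proof.
rewrite /omega_nbhs; case: omega_inf; first exact: nbhs_pinfty_gt.
exact: nbhs_right_gt.
Qed.

Lemma omega_nbhs_scale (x : R) : 0 < x -> t * x @[t --> F] --> F.
Proof.
move=> x0 A; rewrite /omega_nbhs; case: omega_inf.
  move=> [r [r0 rA]]; exists (r / x); split; first exact: num_real.
  by move=> t tr /=; apply: rA; rewrite -ltr_pdivrMr.
move=> [r /= r0 rA]; exists (r / x) => /=; first by rewrite divr_gt0.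
move=> t /=; rewrite sub0r normrN => tr t0; have tx : 0 < t * x by rewrite mulr_gt0.
apply: rA => //=; rewrite sub0r normrN gtr0_norm// -ltr_pdivlMr//.
by rewrite (le_lt_trans (ler_norm t)).
Qed.

End OmegaNbhs.

(** The lower limit is the supremum of the tail infima, so one of them is positive and serves as
    [gam]. *)
Lemma limn_inf_gt0 (R : realType) (u : nat -> R) :
  (forall n, 0 <= u n <= 1) -> 0 < limn_inf u ->
  exists2 gam, 0 < gam & \forall n \near \oo, gam <= u n.
Proof.
move=> u01; rewrite limn_infE; last first.
  exists 1; split=> // M M1 n _ /=; have /andP[u0 u1] := u01 n.
  by rewrite ger0_norm// (le_trans u1)// ltW.
move=> /sup_gt[|_ [n _ <-] n0]; first by exists (infs u 0%N), 0%N.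
exists (infs u n) => //; exists n => // k /= nk; apply: ge_inf; last by exists k.
by exists 0 => _ [j _ <-]; have /andP[] := u01 j.
Qed.

Section AlphaOd.
Variables (R : realType) (E I P : finType) (omega_inf : bool).
Variables (od : P -> I) (pe : P -> seq E) (c : E -> R -> R) (cb : R -> R).
Local Notation alpha e := (alpha_e omega_inf (c e) cb).

(** Supplies the target paths of the rerouting. *)
Lemma alpha_od_lt_pinfty i : (alpha_od omega_inf od pe c cb i < +oo)%E ->
  exists2 p, od p = i & all (fun e => alpha e < +oo)%E (pe p).
Proof.
move=> ai; have [p /eqP pi pf] : exists2 p, od p == i &
    (\big[Order.max/0%E]_(e <- pe p) alpha e < +oo)%E.
  apply/not_exists2P => h; move: ai; apply/negP; rewrite -leNgt.
  by apply: le_bigmin => // p pi; case: (h p) => // /negP; rewrite -leNgt.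
exists p => //; apply/allP => e ep; apply: le_lt_trans pf.
exact: (@le_bigmax_seq _ _ _ _ _ e).
Qed.

Lemma alpha_od_gt0 p : (0 < alpha_od omega_inf od pe c cb (od p))%E ->
  exists2 e, e \in pe p & (0 < alpha e)%E.
Proof.
move=> ai; apply/not_exists2P => h; move: ai; apply/negP; rewrite -leNgt.
apply: (@le_trans _ _ (\big[Order.max/0%E]_(e <- pe p) alpha e)).
  exact: bigmin_le_cond.
rewrite big_seq; elim/big_ind: _ => // [x y x0 y0|e ep]; first by rewrite ge_max x0.
by case: (h e) => // /negP; rewrite -leNgt.
Qed.

End AlphaOd.

(* [delta] is fixed first to absorb the second term, then [eps] small relative to [delta]. *)
Lemma error_budget (R : realType) (N A r tau : R) :
  0 <= N -> 0 <= A -> 0 < r -> 0 < tau ->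
  exists eps delta, [/\ 0 < eps, 0 < delta <= 1 &
    N * (r * (eps + eps / delta)) + A * (r ^+ 2 * delta) <= tau].
Proof.
move=> N0 A0 r0 tau0; have B0 : 0 <= A * r ^+ 2 by rewrite mulr_ge0 ?sqr_ge0.
have B1 : 0 < 2 * (A * r ^+ 2 + 1) by rewrite mulr_gt0// ltr_wpDl.
pose delta := Num.min 1 (tau / (2 * (A * r ^+ 2 + 1))).
have d0 : 0 < delta by rewrite lt_min ltr01/= divr_gt0.
have d1 : delta <= 1 by rewrite ge_min lexx.
have d2 : delta * (2 * (A * r ^+ 2 + 1)) <= tau.
  by rewrite -ler_pdivlMr// ge_min lexx orbT.
have C0 : 0 < 4 * r * (N + 1) by rewrite !mulr_gt0// ltr_wpDl.
(* With [eps = delta * eta] the quotient [eps / delta] no longer depends on [delta], and each of the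
   two error terms is at most [tau / 2]. *)
pose eta := tau / (4 * r * (N + 1)).
have eta0 : 0 < eta by rewrite divr_gt0.
have etaE : eta * (4 * r * (N + 1)) = tau by rewrite divfK// gt_eqF.
exists (delta * eta), delta; split; [exact: mulr_gt0 | by rewrite d0 |].
have -> : delta * eta / delta = eta by rewrite mulrAC divff ?mul1r// gt_eqF.
have de : delta * eta <= eta by rewrite ler_piMl// ltW.
have Nr : 0 <= N * r by rewrite mulr_ge0// ltW.
have re : 0 <= r * eta by rewrite mulr_ge0 ?ltW.
have := ler_wpM2l Nr de; move: d2 etaE.
set s := r ^+ 2; lra.
Qed.

(** * Convergence of the price of anarchy *)

Theorem theorem6p2 (R : realType) (V E I P : finType)
  (src dst : E -> V) (orig dest : I -> V) (od : P -> I) (pe : P -> seq E)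
  (c : E -> R -> R) (cb : R -> R) (omega_inf : bool) (m : nat -> I -> R) :
  (* network: P^i is a nonempty finite set of (distinct) paths from orig i to dest i *)
  (forall p, is_path src dst (orig (od p)) (dest (od p)) (pe p)) ->
  injective pe ->
  (forall i, exists p, od p = i) ->
  (* edge costs: continuous nondecreasing [0,oo) -> [0,oo) *)
  (forall e x, 0 <= x -> 0 <= c e x) ->
  (forall e, {within `[0, +oo[, continuous (c e)}) ->
  (forall e x y, 0 <= x -> x <= y -> c e x <= c e y) ->
  (* benchmark at omega *)
  benchmark omega_inf c cb ->
  (* demands *)
  (forall n i, 0 <= m n i) ->
  (forall n, 0 < \sum_i m n i) ->
  (* (a) *)
  (fun n => \sum_i m n i) @ \oo --> omega_nbhs omega_inf ->
  (* (b) *)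
  (forall i, (alpha_od omega_inf od pe c cb i < +oo)%E) ->
  (* (c) *)
  0 < limn_inf (fun n => \sum_(i | (0 < alpha_od omega_inf od pe c cb i)%E)
                           m n i / \sum_j m n j) ->
  (fun n => PoA od pe c (m n)) @ \oo --> (1 : R).
Proof.
move=> pathP _ od_surj c_ge0 c_cont c_nd [cb_gt0 [rv bench]] m_ge0 M_gt0 Mlim aod.
set posI := fun i => (0 < alpha_od omega_inf od pe c cb i)%E.
move=> share_gt0; pose M n := \sum_i m n i.
pose F := @omega_nbhs R omega_inf; pose FP : ProperFilter F := omega_nbhs_proper R omega_inf.
have F_gt0 : \forall t \near F, 0 < t := omega_nbhs_gt0 R omega_inf.
have F_scale (x : R) : 0 < x -> t * x @[t --> F] --> F by exact: omega_nbhs_scale.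
have pe_uniq p : uniq (pe p).
  by have [_ _ /= /andP[_ /map_uniq]] := pathP p.
pose alpha e := alpha_e omega_inf (c e) cb.
have ratio_alpha e : (c e x / cb x)%:E @[x --> F] --> alpha e.
  have [a ca] := bench e; suff -> : alpha e = a by [].
  exact: (cvg_lim (@ereal_hausdorff R) ca).
have alpha_ge0 e : (0 <= alpha e)%E.
  apply: (cvge_to_ge (ratio_alpha e)); near=> t; have t0 : 0 < t by near: t.
  by rewrite lee_fin divr_ge0 ?c_ge0 ?ltW ?cb_gt0.
pose fin e := (alpha e < +oo)%E; pose a e := fine (alpha e).
have alphaE e : fin e -> alpha e = (a e)%:E.
  by move=> fe; rewrite fineK// ge0_fin_numE.
have a_ge0 e : 0 <= a e by exact: fine_ge0.
have ratio_fin e : fin e -> c e x / cb x @[x --> F] --> a e.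
  by move=> /alphaE ae; have := ratio_alpha e; rewrite ae => /fine_cvgP[].
have ratio_inf e : ~~ fin e -> forall B, \forall x \near F, B <= c e x / cb x.
  rewrite -leNgt leye_eq => /eqP ae B; have := ratio_alpha e; rewrite ae.
  by move=> /cvgeyPge/(_ B); apply: filterS => x; rewrite lee_fin.
have /choice[p0 p0P] : forall i, exists p, od p = i /\ all fin (pe p).
  by move=> i; have [p ? ?] := alpha_od_lt_pinfty (aod i); exists p.
have od_p0 i : od (p0 i) = i := (p0P i).1.
have p0_fin i : all fin (pe (p0 i)) := (p0P i).2.
have pospath p : posI (od p) -> exists2 e, e \in pe p & (0 < alpha e)%E.
  exact: alpha_od_gt0.
have share01 n : 0 <= \sum_(i | posI i) m n i / M n <= 1.
  rewrite sumr_ge0/= => [|i _]; last by rewrite divr_ge0// ltW// M_gt0.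
  rewrite -mulr_suml ler_pdivrMr ?M_gt0// mul1r /M [leRHS](bigID posI)/= lerDl.
  exact: sumr_ge0.
have [gam gam0 gamP] := limn_inf_gt0 share01 share_gt0.
(* By (c) some OD pair has positive alpha; its path [p0 i] avoids infinite edges, so it contains an
   edge with alpha positive and finite, whose cost determines the index. *)
have [rho rho0 cb_rho] : exists2 rho, 0 <= rho &
    forall x : R, 0 < x -> cb (t * x) / cb t @[t --> F] --> x `^ rho.
  have [n gamn] := @filter_ex _ _ _ _ gamP.
  have [i Ii] : exists i, posI i.
    apply/not_existsP => h; move: gamn; apply/negP; rewrite -ltNge big_pred0// => i.
    exact/negP.
  have [e ep ae] : exists2 e, e \in pe (p0 i) & (0 < alpha e)%E.
    by apply: pospath; rewrite od_p0.
  have fe : fin e := allP (p0_fin i) e ep.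
  apply: (regular_variation_index F_gt0 F_scale cb_gt0 rv (@c_nd e) (ratio_fin e fe)).
  by rewrite -lte_fin -alphaE.
pose eta := gam / #|P|.+1%:R; have eta0 : 0 < eta by rewrite divr_gt0.
have [b b0 bP] : exists2 b, 0 < b & forall e, (0 < alpha e)%E ->
    \forall t \near F, b <= c e (t * eta) / cb t.
  have each e : exists2 b, 0 < b & (0 < alpha e)%E ->
      \forall t \near F, b <= c e (t * eta) / cb t.
    have [fe|fe] := boolP (fin e); last first.
      exists 1 => // _; apply: edge_cost_infinite cb_rho _ _ _ _ _ _ => //.
      exact: ratio_inf.
    have [a0|a0] := ltP 0 (a e); last by exists 1; rewrite // alphaE// lte_fin ltNge a0.
    have [b ? ?] := edge_cost_lower F_gt0 F_scale cb_gt0 cb_rho eta0 a0 (ratio_fin e fe).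
    by exists b.
  (* Every small enough [b] suits all of the finitely many edges simultaneously. *)
  have near_b : \forall b \near 0^'+, forall e, (0 < alpha e)%E ->
      \forall t \near F, b <= c e (t * eta) / cb t.
    apply: filter_forall => e; have [b b0 bP] := each e; near=> b' => ae.
    have b'b : b' <= b by near: b'; exact: nbhs_right_le.
    by apply: filterS (bP ae) => t; exact: le_trans.
  have [b [b0 bP]] := @filter_ex _ _ _ _ (filterI (nbhs_right_gt 0) near_b).
  by exists b.
pose kap := eta * b; have kap0 : 0 < kap by rewrite mulr_gt0.
apply/cvgrPdist_le => e0 e00.
(* [kap] bounds [Opt] from below in units of [M cb(M)]. Two errors of size [tau] will occur,
   near-optimality of [w] and the error budget; together they make [e0 * kap]. *)
pose tau := kap * e0 / 2; have tau0 : 0 < tau by rewrite divr_gt0// mulr_gt0.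
pose A := \sum_(e | fin e) a e; have A0 : 0 <= A by exact: sumr_ge0.
have r0 : 0 < 1 + rho by rewrite ltr_wpDr.
have [eps [delta [eps0 dd errP]]] := error_budget (ler0n R #|E|) A0 r0 tau0.
have /andP[d0 d1] := dd.
pose K := \sum_(e | fin e) (a e + 1).
have K0 : 0 <= K by apply: sumr_ge0 => e _; rewrite addr_ge0.
pose zeta := delta / (#|P| ^ 2).+1%:R; have zeta0 : 0 < zeta by rewrite divr_gt0.
have near_low : \forall t \near F, forall e, (0 < alpha e)%E -> b <= c e (t * eta) / cb t.
  apply: filter_forall => e; have [ae|ae] := boolP (0 < alpha e)%E; last exact: nearW.
  by apply: filterS (bP e ae).
have near_up : \forall t \near F, forall e, fin e -> c e t / cb t <= a e + 1.
  apply: filter_forall => e; have [fe|fe] := boolP (fin e); last exact: nearW.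
  have /cvgr_lt := ratio_fin e fe => /(_ (a e + 1)).
  by rewrite ltrDl => /(_ ltr01); apply: filterS => t /ltW.
(* [K] will bound [Opt] in the same units, so a load share [zeta] on an infinite edge would cost
   more than [Opt] plus [tau]. *)
have near_inf : \forall t \near F, forall e, ~~ fin e ->
    (K + tau + 1) / zeta <= c e (t * zeta) / cb t.
  apply: filter_forall => e; have [fe|fe] := boolP (~~ fin e); last exact: nearW.
  have B0 : 0 <= (K + tau + 1) / zeta.
    by rewrite divr_ge0 ?(ltW zeta0)// !addr_ge0// ltW.
  have := edge_cost_infinite F_gt0 F_scale cb_gt0 cb_rho zeta0 B0 (ratio_inf e fe).
  by move=> h; apply: (@filterS _ F _ _ _ _ (h FP)) => t ht _.
have near_unif : \forall t \near F, forall e, fin e -> forall u, 0 <= u <= 1 ->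
    `|u * (c e (t * u) / cb t) - a e * u `^ (1 + rho)| <= eps.
  apply: filter_forall => e; have [fe|fe] := boolP (fin e); last exact: nearW.
  have := edge_cost_uniform F_gt0 F_scale cb_gt0 rho0 cb_rho (@c_ge0 e) (@c_nd e)
    (ratio_fin e fe) eps0.
  by move=> h; apply: (@filterS _ F _ _ _ _ (h FP)) => t ht _.
near=> n.
have low : forall e, (0 < alpha e)%E -> b <= c e (M n * eta) / cb (M n).
  by near: n; exact: Mlim near_low.
have up : forall e, fin e -> c e (M n) / cb (M n) <= a e + 1.
  by near: n; exact: Mlim near_up.
have inf_large : forall e, ~~ fin e ->
    (K + tau + 1) / zeta <= c e (M n * zeta) / cb (M n).
  by near: n; exact: Mlim near_inf.
have unif : forall e, fin e -> forall u, 0 <= u <= 1 ->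
    `|u * (c e (M n * u) / cb (M n)) - a e * u `^ (1 + rho)| <= eps.
  by near: n; exact: Mlim near_unif.
have gamn : gam <= \sum_(i | posI i) m n i / M n by near: n.
have Mn := M_gt0 n; have s0 := cb_gt0 _ Mn.
set s := cb _ in s0; have Ms0 : 0 < M n * s by rewrite mulr_gt0.
have Olow := Opt_lower od_surj c_ge0 c_nd (m_ge0 n) Mn s0 pospath gam0 gamn low.
have Oup := Opt_upper od_surj c_ge0 c_nd od_p0 p0_fin (m_ge0 n) Mn s0 up.
have [f fW EqE] := Eq_wardrop (wardrop_eq_exists pe_uniq od_surj c_cont c_nd (m_ge0 n)).
have tMs : 0 < tau * (M n * s) by rewrite mulr_gt0.
have [w fw wO] := Opt_approx pe od_surj c_ge0 (m_ge0 n) tMs.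
(* A larger load would contradict near-optimality of [w]. *)
have winf e : ~~ fin e -> load pe w e <= M n * zeta.
  move=> fe; rewrite leNgt; apply/negP => /ltW wl.
  have x0 : 0 <= M n * zeta by rewrite mulr_ge0 ?ltW.
  have := social_cost_edge_ge c_ge0 c_nd fw x0 wl.
  have := inf_large e fe; rewrite ler_pdivrMr// mulrAC ler_pdivlMr// => cl.
  have := ler_wpM2l (ltW Mn) cl.
  have -> : M n * ((K + tau + 1) * s) = (K + tau) * (M n * s) + M n * s by ring.
  move: Oup wO; rewrite -/K -/(M n).
  set L := social_cost _ _ _; set X := c e _.
  have -> : M n * (X * zeta) = M n * zeta * X by ring.
  lra.
have Eup := Eq_le_approx pe_uniq od_surj c_ge0 c_nd od_p0 p0_fin Mn s0
  (fun e _ => a_ge0 e) rho0 eps0 dd unif fW fw winf.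
have Oeq : Opt od pe c (m n) <= Eq od pe c (m n).
  by rewrite EqE; apply: (Opt_le pe c_ge0); exact: fW.1.
have O0 : 0 < Opt od pe c (m n).
  by apply: lt_le_trans Olow; rewrite !mulr_gt0.
rewrite /PoA gt_eqF// distrC ger0_norm; last first.
  by rewrite subr_ge0 ler_pdivlMr// mul1r.
(* It remains to see that the equilibrium cost is at most [Opt] plus two errors [tau M cb(M)], hence
   at most [(1 + e0) Opt]. *)
rewrite lerBlDr ler_pdivrMr// EqE.
have err := ler_wpM2r (ltW Ms0) errP.
have := ler_wpM2l (ltW e00) Olow; rewrite -/eta -/kap.
have -> : e0 * (kap * (M n * s)) = 2 * (tau * (M n * s)) by rewrite /tau; field.
move: Eup err wO; rewrite -/A -/(M n) -/s [X in _ -> _ -> _ -> _ -> is_true (_ <= X)]mulrDl mul1r.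
set T := tau * _; set X := _ * (M n * s); lra.
Unshelve. all: by end_near. Qed.
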